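(* Every space which is not CM has at most $2N_0+4$ different rational angles, where $N_0=2^6\cdot 3^4\cdot 5^3\cdot\big(\prod_{7\le p\le 37,\ p\text{ prime}}p\big)^2$.
   Context: A space is a $2$-dimensional $\mathbb{Q}$-vector subspace $V\subset\mathbb{C}$ containing two $\mathbb{R}$-linearly independent vectors. $V$ is CM if there is $\lambda\in\mathbb{C}\setminus\mathbb{Q}$ with $\lambda V\subseteq V$. A rational angle of $V$ is an ordered pair of distinct lines $(\mathbb{R}v_1,\mathbb{R}v_2)$ with $v_1,v_2\in V\setminus\{0\}$, $v_2/v_1\notin\mathbb{R}$, $\arg(v_2/v_1)\in\mathbb{Q}\pi$; rational angles obtained from each other by swapping the two lines are regarded as equivalent (not different). *)

(* Defs.v *)
From Stdlib Require Import Reals QArith Qreals List ZArith.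
From Coquelicot Require Import Coquelicot.
Open Scope R_scope.

Definition is_rat (x : R) : Prop := exists q : Q, x = Q2R q.

Definition in_span (u w z : C) : Prop :=
  exists a b : R, is_rat a /\ is_rat b /\
    z = Cplus (Cmult (RtoC a) u) (Cmult (RtoC b) w).

Definition Q_lin_indep (u w : C) : Prop :=
  forall a b : R, is_rat a -> is_rat b ->
    Cplus (Cmult (RtoC a) u) (Cmult (RtoC b) w) = RtoC 0 -> a = 0 /\ b = 0.

Definition R_lin_indep (v1 v2 : C) : Prop :=
  forall a b : R,
    Cplus (Cmult (RtoC a) v1) (Cmult (RtoC b) v2) = RtoC 0 -> a = 0 /\ b = 0.

(* (u, w) is a Q-basis of a space V: a 2-dimensional Q-subspace of C
   containing two R-linearly independent vectors. *)
Definition is_space (u w : C) : Prop :=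
  Q_lin_indep u w /\
  exists v1 v2 : C, in_span u w v1 /\ in_span u w v2 /\ R_lin_indep v1 v2.

Definition is_CM (u w : C) : Prop :=
  exists lam : C, ~ (exists q : Q, lam = RtoC (Q2R q)) /\
    forall z, in_span u w z -> in_span u w (Cmult lam z).

Definition line (v : C) : C -> Prop := fun z => exists r : R, z = Cmult (RtoC r) v.

Definition same_line (L M : C -> Prop) : Prop := forall z, L z <-> M z.

Definition is_real (z : C) : Prop := Im z = 0.

Definition rational_arg (z : C) : Prop :=
  exists q : Q, z = Cmult (RtoC (Cmod z)) (cos (Q2R q * PI), sin (Q2R q * PI)).

Definition rational_angle (u w : C) (A : (C -> Prop) * (C -> Prop)) : Prop :=
  exists v1 v2 : C,
    in_span u w v1 /\ in_span u w v2 /\ v1 <> RtoC 0 /\ v2 <> RtoC 0 /\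
    same_line (fst A) (line v1) /\ same_line (snd A) (line v2) /\
    ~ same_line (fst A) (snd A) /\
    ~ is_real (Cdiv v2 v1) /\ rational_arg (Cdiv v2 v1).

Definition angle_equiv (A B : (C -> Prop) * (C -> Prop)) : Prop :=
  (same_line (fst A) (fst B) /\ same_line (snd A) (snd B)) \/
  (same_line (fst A) (snd B) /\ same_line (snd A) (fst B)).

Definition N0 : Z :=
  (2 ^ 6 * 3 ^ 4 * 5 ^ 3 *
   (7 * 11 * 13 * 17 * 19 * 23 * 29 * 31 * 37) ^ 2)%Z.

Definition angle_bound : Z := (2 * N0 + 4)%Z.

(* Main.v *)
Require Import Defs.
From Stdlib Require Import Reals QArith Qreals List ZArith Lra Epsilon.
From Coquelicot Require Import Coquelicot.

(** If the angle from [v1] to [v2] is [rho], then [cot rho = dot v1 v2 / cross v1 v2],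
so all cotangents of angles of [V] lie in one [Q]-space of dimension at most 3:
any four of them are linearly dependent over [Q]. Moreover, if three
inequivalent angles have the same cotangent, the rotation by [rho] carries three
rational lines of [V] to rational lines, so a real multiple of it preserves [V],
which is then CM. It remains to bound the number of roots of unity
[y = exp (2 i rho)] such that any four of the numbers
[i cot rho = (1 + y) / (1 - y)] are dependent over [Q].

Let [m] be a common order of these [y]. If [m] does not divide [1800], some prime
power [q = p ^ f >= 7] divides [m] such that either [p q] divides [m] or [q = p].
Consider those [y] with [y ^ (m / p) <> 1]. A dependence relation between four of
them can be conjugated by the automorphisms [y |-> y ^ (1 + (m / q) i)], which
turns it into an identity [sum c_j (1 + y_j x ^ k_j) / (1 - y_j x ^ k_j) = 0]
valid for at least [q - 1] of the [q]-th roots of unity [x]. If all [k_j] are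
equal to 1, or if they are distinct and smaller than [q / 4], then after clearing
denominators the degree is too small for that many roots, and the identity of
rational functions forces all [c_j] to vanish. Replacing [x] by a power of [x],
one of these cases occurs as soon as there are more than 75 such [y]. The
remaining [y], with [y ^ (m / p) = 1], satisfy a shorter dependence condition
(three instead of four, and so on), because a relation involving one further
element can be conjugated by an automorphism fixing all of them but that
element. *)

(** * Cotangents of the angles of a space *)

Lemma is_rat_plus (x y : R) : is_rat x -> is_rat y -> is_rat (x + y).
Proof. intros [p ->] [q ->]. exists (p + q)%Q. now rewrite Q2R_plus. Qed.

Lemma is_rat_minus (x y : R) : is_rat x -> is_rat y -> is_rat (x - y).
Proof. intros [p ->] [q ->]. exists (p - q)%Q. now rewrite Q2R_minus. Qed.

Lemma is_rat_mult (x y : R) : is_rat x -> is_rat y -> is_rat (x * y).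
Proof. intros [p ->] [q ->]. exists (p * q)%Q. now rewrite Q2R_mult. Qed.

Lemma is_rat_div (x y : R) : y <> 0 -> is_rat x -> is_rat y -> is_rat (x / y).
Proof.
  intros y0 [p ->] [q ->]. exists (p / q)%Q. rewrite Q2R_div; trivial.
  intros q0. apply y0. rewrite <- RMicromega.Q2R_0. now apply Qeq_eqR.
Qed.

Definition cross (v1 v2 : C) : R := Re v1 * Im v2 - Im v1 * Re v2.

Definition dot (v1 v2 : C) : R := Re v1 * Re v2 + Im v1 * Im v2.

Lemma in_span_lincomb (u w v1 v2 : C) (a b : R) :
  in_span u w v1 -> in_span u w v2 -> is_rat a -> is_rat b ->
  in_span u w (Cplus (Cmult (RtoC a) v1) (Cmult (RtoC b) v2)).
Proof.
  intros (a1 & b1 & ra1 & rb1 & ->) (a2 & b2 & ra2 & rb2 & ->) ra rb.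
  exists (a * a1 + b * a2), (a * b1 + b * b2).
  repeat split; try (apply is_rat_plus; apply is_rat_mult; assumption).
  rewrite !RtoC_plus, !RtoC_mult. ring.
Qed.

(** By bilinearity each cross product of vectors of the span is a rational determinant times
    [cross u w], and this factor cancels in the quotient. *)
Lemma cross_ratio_is_rat (u w v1 v2 v3 v4 : C) :
  in_span u w v1 -> in_span u w v2 -> in_span u w v3 -> in_span u w v4 ->
  cross v3 v4 <> 0 -> is_rat (cross v1 v2 / cross v3 v4).
Proof.
  intros (a1 & b1 & ra1 & rb1 & E1) (a2 & b2 & ra2 & rb2 & E2)
    (a3 & b3 & ra3 & rb3 & E3) (a4 & b4 & ra4 & rb4 & E4).
  assert (H : forall a b c d, cross (Cplus (Cmult (RtoC a) u) (Cmult (RtoC b) w))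
    (Cplus (Cmult (RtoC c) u) (Cmult (RtoC d) w)) = (a * d - c * b) * cross u w).
  { intros. destruct u, w. unfold cross, Cplus, Cmult, RtoC, Re, Im; simpl. ring. }
  subst. rewrite !H. intros nz.
  assert (n1 : cross u w <> 0) by (intros e; apply nz; rewrite e; ring).
  assert (n2 : a3 * b4 - a4 * b3 <> 0) by (intros e; apply nz; rewrite e; ring).
  replace (_ / _) with ((a1 * b2 - a2 * b1) / (a3 * b4 - a4 * b3)) by (field; auto).
  apply is_rat_div; trivial; apply is_rat_minus; apply is_rat_mult; trivial.
Qed.

(** Cramer's rule: the coordinates are ratios of cross products, hence rational when all vectors lie
    in the span. *)
Lemma cross_decomp (v1 v2 v : C) :
  cross v1 v2 <> 0 ->
  v = Cplus (Cmult (RtoC (cross v v2 / cross v1 v2)) v1)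
        (Cmult (RtoC (cross v1 v / cross v1 v2)) v2).
Proof.
  destruct v1 as [x1 y1], v2 as [x2 y2], v as [x y].
  unfold cross, Cplus, Cmult, RtoC; simpl; intros nz; f_equal; field; trivial.
Qed.

Lemma line_scal (v : C) (r : R) : r <> 0 -> same_line (line v) (line (Cmult (RtoC r) v)).
Proof.
  intros r0 z; split; intros [s ->].
  - exists (s / r). rewrite Cmult_assoc, <- RtoC_mult. do 2 f_equal. now field.
  - exists (s * r). now rewrite Cmult_assoc, <- RtoC_mult.
Qed.

Lemma same_line_sym (L M : C -> Prop) : same_line L M -> same_line M L.
Proof. intros H z; symmetry; apply H. Qed.

Lemma same_line_trans (L M N : C -> Prop) : same_line L M -> same_line M N -> same_line L N.
Proof. intros H K z; now rewrite (H z). Qed.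

Definition angle_cot (u w : C) (A : (C -> Prop) * (C -> Prop)) (k : R) : Prop :=
  exists v1 v2 : C, in_span u w v1 /\ in_span u w v2 /\
    same_line (fst A) (line v1) /\ same_line (snd A) (line v2) /\
    cross v1 v2 <> 0 /\ dot v1 v2 = k * cross v1 v2.

(** The real and imaginary parts of [v2 / v1] are [dot v1 v2] and [cross v1 v2] divided by the
    squared modulus of [v1], so their quotient is the cotangent of the argument. *)
Lemma rational_angle_cot (u w : C) (A : (C -> Prop) * (C -> Prop)) :
  rational_angle u w A ->
  exists k : R, angle_cot u w A k /\
    exists q : Q, sin (Q2R q * PI) <> 0 /\ k = cos (Q2R q * PI) / sin (Q2R q * PI).
Proof.
  intros (v1 & v2 & s1 & s2 & n1 & n2 & l1 & l2 & _ & nr & [q E]).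
  set (t := Q2R q * PI) in *.
  assert (N0 : 0 < Re v1 * Re v1 + Im v1 * Im v1).
  { destruct v1 as [x y]; unfold Re, Im; simpl.
    destruct (Req_dec x 0) as [->|hx]; [destruct (Req_dec y 0) as [->|hy]|]; [easy|nra|nra]. }
  set (m := Cmod (Cdiv v2 v1)) in *.
  assert (Ec : cross v1 v2 = (Re v1 * Re v1 + Im v1 * Im v1) * (m * sin t)).
  { assert (Im (Cdiv v2 v1) = m * sin t) as <- by (rewrite E; unfold Cmult, RtoC, Re, Im; simpl; ring).
    destruct v1 as [x1 y1], v2 as [x2 y2]; unfold cross; simpl in *; field; nra. }
  assert (Ed : dot v1 v2 = (Re v1 * Re v1 + Im v1 * Im v1) * (m * cos t)).
  { assert (Re (Cdiv v2 v1) = m * cos t) as <- by (rewrite E; unfold Cmult, RtoC, Re, Im; simpl; ring).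
    destruct v1 as [x1 y1], v2 as [x2 y2]; unfold dot; simpl in *; field; nra. }
  assert (ms : m * sin t <> 0).
  { intros e; apply nr. unfold is_real. rewrite E; unfold Cmult, RtoC, Im; simpl. lra. }
  assert (st : sin t <> 0) by (intros e; apply ms; rewrite e; ring).
  exists (cos t / sin t); split; [|exists q; easy].
  exists v1, v2; repeat (split; [easy|]). rewrite Ec, Ed. split; [|field; easy].
  intros e; apply Rmult_integral in e; destruct e; [lra|easy].
Qed.

(* A rotation by [k + i] up to scaling carries the first line to the second. *)
Lemma angle_cot_rotation (v1 v2 : C) (k : R) :
  cross v1 v2 <> 0 -> dot v1 v2 = k * cross v1 v2 ->
  exists r : R, r <> 0 /\ v2 = Cmult (Cmult (RtoC r) (k, 1)) v1.
Proof.
  destruct v1 as [x1 y1], v2 as [x2 y2]; unfold cross, dot; simpl; intros nz E.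
  assert (N0 : x1 * x1 + y1 * y1 <> 0).
  { intros e. assert (x1 = 0) by nra. assert (y1 = 0) by nra. subst. apply nz; ring. }
  exists ((x1 * y2 - y1 * x2) / (x1 * x1 + y1 * y1)); split.
  - intros e. apply nz.
    replace (x1 * y2 - y1 * x2) with
      ((x1 * y2 - y1 * x2) / (x1 * x1 + y1 * y1) * (x1 * x1 + y1 * y1)) by (field; easy).
    rewrite e; ring.
  - unfold Cmult, RtoC; simpl.
    assert (k = (x1 * x2 + y1 * y2) / (x1 * y2 - y1 * x2)) as -> by (rewrite E; field; easy).
    f_equal; field; auto.
Qed.

(** If [v1] and [v2] are parallel, then so are their images under the common rotation: the lines
    agree in order, without a swap. *)
Lemma angle_cot_equiv (u w v1 v2 v1' v2' : C) (A B : (C -> Prop) * (C -> Prop)) (k r1 r2 : R) :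
  same_line (fst A) (line v1) -> same_line (snd A) (line v1') ->
  same_line (fst B) (line v2) -> same_line (snd B) (line v2') ->
  v1 <> RtoC 0 -> v2 <> RtoC 0 -> r1 <> 0 -> r2 <> 0 ->
  v1' = Cmult (Cmult (RtoC r1) (k, 1)) v1 -> v2' = Cmult (Cmult (RtoC r2) (k, 1)) v2 ->
  cross v1 v2 = 0 -> angle_equiv A B.
Proof.
  intros a1 a2 b1 b2 n1 n2 r10 r20 E1 E2 c.
  assert (exists s, s <> 0 /\ v2 = Cmult (RtoC s) v1) as (s & s0 & Es).
  { assert (N0 : Re v1 * Re v1 + Im v1 * Im v1 <> 0).
    { intros e. apply n1. destruct v1 as [x y]; simpl in *.
      assert (x = 0) by nra. assert (y = 0) by nra. now subst. }
    exists (dot v1 v2 / (Re v1 * Re v1 + Im v1 * Im v1)).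
    assert (Es : v2 = Cmult (RtoC (dot v1 v2 / (Re v1 * Re v1 + Im v1 * Im v1))) v1).
    { destruct v1 as [x1 y1], v2 as [x2 y2]; unfold cross, dot, Cmult, RtoC in *; simpl in *.
      f_equal.
      - transitivity (((x1 * x2 + y1 * y2) * x1 - y1 * (x1 * y2 - y1 * x2)) / (x1 * x1 + y1 * y1));
          [|rewrite c]; field; trivial.
      - transitivity (((x1 * x2 + y1 * y2) * y1 + x1 * (x1 * y2 - y1 * x2)) / (x1 * x1 + y1 * y1));
          [|rewrite c]; field; trivial. }
    split; trivial. intros e; apply n2. rewrite Es, e. ring. }
  left; split.
  - apply same_line_trans with (1 := a1), same_line_sym.
    apply same_line_trans with (1 := b1), same_line_sym. rewrite Es. now apply line_scal.
  - apply same_line_trans with (1 := a2), same_line_sym.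
    apply same_line_trans with (1 := b2), same_line_sym.
    replace v2' with (Cmult (RtoC (s * (r2 / r1))) v1').
    + apply line_scal. unfold Rdiv.
      repeat apply Rmult_integral_contrapositive_currified; trivial. now apply Rinv_neq_0_compat.
    + rewrite E1, E2, Es. destruct v1 as [x y].
      unfold Cmult, RtoC; simpl. f_equal; field; trivial.
Qed.

(* Three pairs of lines of [V] exchanged by the same rotation: in suitable
   [Q]-bases of [V] the rotation is a multiple of a rational matrix. *)
Lemma three_equal_cot_CM (u w : C) (A1 A2 A3 : (C -> Prop) * (C -> Prop)) (k : R) :
  angle_cot u w A1 k -> angle_cot u w A2 k -> angle_cot u w A3 k ->
  ~ angle_equiv A1 A2 -> ~ angle_equiv A1 A3 -> ~ angle_equiv A2 A3 -> is_CM u w.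
Proof.
  intros (v1 & w1 & s1 & t1 & l1 & m1 & c1 & d1) (v2 & w2 & s2 & t2 & l2 & m2 & c2 & d2)
    (v3 & w3 & s3 & t3 & l3 & m3 & c3 & d3) n12 n13 n23.
  assert (nz : forall v w, cross v w <> 0 -> v <> RtoC 0).
  { intros v w' h e. apply h. rewrite e. unfold cross; simpl. ring. }
  destruct (angle_cot_rotation _ _ _ c1 d1) as (r1 & r10 & E1).
  destruct (angle_cot_rotation _ _ _ c2 d2) as (r2 & r20 & E2).
  destruct (angle_cot_rotation _ _ _ c3 d3) as (r3 & r30 & E3).
  assert (c12 : cross v1 v2 <> 0).
  { intros e; apply n12. exact (angle_cot_equiv u w v1 v2 w1 w2 A1 A2 k r1 r2 l1 m1 l2 m2
      (nz _ _ c1) (nz _ _ c2) r10 r20 E1 E2 e). }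
  assert (c13 : cross v1 v3 <> 0).
  { intros e; apply n13. exact (angle_cot_equiv u w v1 v3 w1 w3 A1 A3 k r1 r3 l1 m1 l3 m3
      (nz _ _ c1) (nz _ _ c3) r10 r30 E1 E3 e). }
  assert (c23 : cross v2 v3 <> 0).
  { intros e; apply n23. exact (angle_cot_equiv u w v2 v3 w2 w3 A2 A3 k r2 r3 l2 m2 l3 m3
      (nz _ _ c2) (nz _ _ c3) r20 r30 E2 E3 e). }
  assert (cr : forall r s x y, cross (Cmult (Cmult (RtoC r) (k, 1)) x)
      (Cmult (Cmult (RtoC s) (k, 1)) y) = r * s * (k * k + 1) * cross x y).
  { intros r s [x y] [x' y']. unfold cross, Cmult, RtoC, Re, Im; simpl. ring. }
  assert (k1 : k * k + 1 <> 0) by nra.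
  (* This is where the third pair enters: in [cross w1 w3 / cross w2 w3] the factors [r3] and
     [k * k + 1] cancel, leaving [r1 / r2] times a rational ratio. *)
  assert (rr : is_rat (r1 / r2)).
  { replace (r1 / r2) with
      ((cross w1 w3 / cross w2 w3) * (cross v2 v3 / cross v1 v3)).
    - apply is_rat_mult.
      + apply cross_ratio_is_rat with u w; trivial. rewrite E2, E3, cr.
        repeat apply Rmult_integral_contrapositive_currified; trivial.
      + apply cross_ratio_is_rat with u w; trivial.
    - rewrite E1, E2, E3, !cr. field. auto. }
  (* This multiplier sends [v1] to [w1] and [v2] to [r1 / r2] times [w2]; its imaginary part is
     [r1], which is nonzero. *)
  exists (Cmult (RtoC r1) (k, 1)); split.
  - intros [q e]. apply (f_equal Im) in e. simpl in e. apply r10. lra.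
  - intros z sz. rewrite (cross_decomp v1 v2 z c12) at 1.
    set (a := cross z v2 / _). set (b := cross v1 z / _).
    replace (Cmult _ _) with (Cplus (Cmult (RtoC a) w1) (Cmult (RtoC (b * (r1 / r2))) w2)).
    + apply in_span_lincomb; trivial; [|apply is_rat_mult; trivial];
        apply cross_ratio_is_rat with u w; trivial.
    + rewrite E1, E2, RtoC_mult. destruct v1, v2; unfold Cmult, Cplus, RtoC; simpl.
      f_equal; field; trivial.
Qed.

Lemma cos_sin_2IZR (z : Z) : cos (2 * (IZR z * PI)) = 1 /\ sin (2 * (IZR z * PI)) = 0.
Proof.
  assert (s0 : sin (IZR z * PI) = 0) by (apply sin_eq_0_1; now exists z).
  rewrite cos_2a_sin, sin_2a, s0. split; ring.
Qed.

Lemma Qden_mul_angle (q : Q) :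
  INR (Pos.to_nat (Qden q)) * (2 * (Q2R q * PI)) = 2 * (IZR (Qnum q) * PI).
Proof.
  unfold Q2R. rewrite INR_IZR_INZ, positive_nat_Z. field. now apply IZR_neq.
Qed.

Lemma cos_double_eq1 (t : R) : cos (2 * t) = 1 -> sin t = 0.
Proof. rewrite cos_2a_sin. intros e. apply Rsqr_0_uniq. unfold Rsqr. lra. Qed.

Lemma cot_double_angle (t : R) : sin t <> 0 ->
  cos t / sin t * sin (2 * t) = 1 + cos (2 * t) /\
  cos t / sin t * (1 - cos (2 * t)) = sin (2 * t).
Proof.
  intros s0. split.
  - rewrite cos_2a_cos, sin_2a. field; trivial.
  - rewrite cos_2a_sin, sin_2a. field; trivial.
Qed.

(** [dot v1 v2] expands bilinearly, while [cross v1 v2] is the rational determinant [D] times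
    [cross u w]. The three generators do not depend on the angle. *)
Lemma angle_cot_lincomb (u w : C) (A : (C -> Prop) * (C -> Prop)) (k : R) :
  angle_cot u w A k -> exists a b c : R, is_rat a /\ is_rat b /\ is_rat c /\
    k = a * (dot u u / cross u w) + b * (dot w w / cross u w) + c * (dot u w / cross u w).
Proof.
  intros (v1 & v2 & (a1 & b1 & ra1 & rb1 & E1) & (a2 & b2 & ra2 & rb2 & E2) & _ & _ & nz & E).
  set (D := a1 * b2 - a2 * b1).
  assert (Ec : cross v1 v2 = D * cross u w).
  { subst v1 v2 D. destruct u, w. unfold cross, Cplus, Cmult, RtoC, Re, Im; simpl. ring. }
  assert (Ed : dot v1 v2 = a1 * a2 * dot u u + b1 * b2 * dot w w + (a1 * b2 + a2 * b1) * dot u w).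
  { subst v1 v2 D. destruct u, w. unfold dot, Cplus, Cmult, RtoC, Re, Im; simpl. ring. }
  assert (D0 : D <> 0) by (intros e; apply nz; rewrite Ec, e; ring).
  assert (c0 : cross u w <> 0) by (intros e; apply nz; rewrite Ec, e; ring).
  assert (rD : is_rat D) by (apply is_rat_minus; apply is_rat_mult; trivial).
  exists (a1 * a2 / D), (b1 * b2 / D), ((a1 * b2 + a2 * b1) / D).
  split; [|split; [|split]].
  - apply is_rat_div; trivial. now apply is_rat_mult.
  - apply is_rat_div; trivial. now apply is_rat_mult.
  - apply is_rat_div; trivial. now apply is_rat_plus; apply is_rat_mult.
  - rewrite Ec, Ed in E. apply Rmult_eq_reg_r with (D * cross u w).
    + rewrite <- E. field. auto.
    + now apply Rmult_integral_contrapositive_currified.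
Qed.

From HB Require Import structures.
From mathcomp Require Import all_boot all_order all_algebra all_solvable all_field.
From mathcomp Require Import complex Rstruct.
From mathcomp Require Import ring lra zify.
Set Implicit Arguments.
Unset Strict Implicit.
Unset Printing Implicit Defensive.
Import Order.TTheory GRing.Theory Num.Theory.
Local Open Scope ring_scope.

(** * Galois conjugation of relations between cotangents *)

Local Notation pQto F := (map_poly (ratr : rat -> F)).

Lemma exists_prim_root (F : numClosedFieldType) (n : nat) :
  (0 < n)%N -> exists z : F, n.-primitive_root z.
Proof.
move=> n_gt0; pose p : {poly F} := 'X^n - 1.
have [r Dp] := closed_field_poly_normal p.
rewrite (monicP _) ?monicXnsubC // scale1r in Dp.
have rn1: all n.-unity_root r by apply/allP=> z; rewrite -root_prod_XsubC -Dp.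
have sz_r: (n < (size r).+1)%N.
  by rewrite -(size_prod_XsubC r id) -Dp size_XnsubC.
have [|z] := hasP (has_prim_root n_gt0 rn1 _ sz_r); last by exists z.
by rewrite -separable_prod_XsubC -Dp separable_Xn_sub_1 // pnatr_eq0 -lt0n.
Qed.

(** [X^n - 1] is the product of the ['Phi_d] with [d] dividing [n]; a root of ['Phi_d] has order
    dividing [d], which forces [d = n]. *)
Lemma Cyclotomic_prim_root (F : numClosedFieldType) (n : nat) (z : F) :
  n.-primitive_root z -> root (map_poly intr 'Phi_n) z.
Proof.
move=> pz; have n_gt0 := prim_order_gt0 pz.
have: root (map_poly (intr : int -> F) ('X^n - 1)) z.
  rewrite rmorphB rmorph1 /= map_polyXn.
  by apply/rootP; rewrite !hornerE prim_expr_order // subrr.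
rewrite -prod_Cyclotomic // rmorph_prod /= rootE horner_prod prodf_seq_eq0.
case/hasP=> d; rewrite -dvdn_divisors //= => d_n rd.
have d_gt0 : (0 < d)%N by apply: dvdn_gt0 d_n.
suff : z ^+ d = 1.
  move/eqP; rewrite -(prim_order_dvd pz) => n_d.
  by have /eqP -> : n == d by rewrite eqn_dvd n_d d_n.
have : root (map_poly (intr : int -> F) ('X^d - 1)) z.
  rewrite -prod_Cyclotomic // rmorph_prod /= rootE horner_prod prodf_seq_eq0.
  by apply/hasP; exists d; rewrite -?dvdn_divisors.
rewrite rmorphB rmorph1 /= map_polyXn => /rootP.
by rewrite !hornerE => /eqP; rewrite subr_eq0 => /eqP.
Qed.

(** Irreducibility of ['Phi_n], available through minimal polynomials in [algC], is transferred to
    [F]: either ['Phi_n] divides its gcd with [P], or the two are coprime, and then a Bezout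
    identity evaluated at [z] is absurd. *)
Lemma Cyclotomic_dvdp (F : numClosedFieldType) (n : nat) (z : F) (P : {poly rat}) :
  n.-primitive_root z -> root (pQto F P) z -> map_poly intr 'Phi_n %| P.
Proof.
move=> pz rP; set Q := map_poly intr 'Phi_n.
have n_gt0 := prim_order_gt0 pz.
have [w pw] := C_prim_root_exists n_gt0.
have [p [Dp mon_p dvp]] := minCpolyP w.
have Ep : p = Q.
  apply: (map_inj_poly (fmorph_inj (ratr : rat -> algC))); rewrite ?rmorph0 //.
  rewrite -Dp (minCpoly_cyclotomic pw) -(Cintr_Cyclotomic pw).
  rewrite -map_poly_comp; apply: eq_map_poly => a /=.
  by rewrite ratr_int.
have QF : pQto F Q = map_poly intr 'Phi_n.
  by rewrite -map_poly_comp; apply: eq_map_poly => a /=; rewrite ratr_int.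
have rQ : root (pQto F Q) z by rewrite QF; apply: Cyclotomic_prim_root.
rewrite Ep in dvp mon_p.
have [h Dh] := dvdpP _ _ (dvdp_gcdl Q P).
have Q0 : Q != 0 by rewrite monic_neq0.
have : root (pQto algC Q) w by rewrite dvp.
rewrite {1}Dh rmorphM rootM /= !dvp => /orP[Qh|Qg]; last first.
  exact: (dvdp_trans Qg (dvdp_gcdr _ _)).
have cop : coprimep Q P.
  rewrite /coprimep.
  have h0 : h != 0 by apply: contraNneq Q0 => h0; rewrite Dh h0 mul0r.
  have g0 : gcdp Q P != 0 by rewrite gcdp_eq0 negb_and Q0.
  have := dvdp_leq h0 Qh; rewrite {1}Dh size_mul // => sz.
  have : (0 < size (gcdp Q P))%N by rewrite size_poly_gt0.
  have : (0 < size h)%N by rewrite size_poly_gt0.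
  by move: sz; move: (size h) (size (gcdp Q P)) => a b; lia.
have [[u v] /= E] := Bezout_eq1_coprimepP _ _ cop.
have /eqP := congr1 (fun r => (pQto F r).[z]) E.
rewrite rmorphD !rmorphM rmorph1 /= hornerD !hornerM (rootP rP) (rootP rQ).
by rewrite !mulr0 addr0 hornerC eq_sym oner_eq0.
Qed.

(** This replaces the Galois automorphism [z |-> z ^+ k], without constructing a field automorphism
    of [F]. *)
Lemma prim_root_conj (F : numClosedFieldType) (n k : nat) (z : F) (P : {poly rat}) :
  n.-primitive_root z -> coprime k n ->
  root (pQto F P) z -> root (pQto F P) (z ^+ k).
Proof.
move=> pz kn rP; have [Q ->] := dvdpP _ _ (Cyclotomic_dvdp pz rP).
rewrite rmorphM rootM /= -map_poly_comp.
rewrite [X in _ || root X _](_ : _ = map_poly intr 'Phi_n); last first.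
  by apply: eq_map_poly => a /=; rewrite ratr_int.
by rewrite Cyclotomic_prim_root ?orbT // prim_root_exp_coprime.
Qed.

(* For [y = exp (2 i rho)] this is [i * cot rho]. *)
Definition icot (F : fieldType) (y : F) : F := (1 + y) / (1 - y).

Lemma icot_inj (F : numFieldType) (x y : F) :
  x != 1 -> y != 1 -> icot x = icot y -> x = y.
Proof.
move=> x1 y1 /eqP; rewrite /icot eqr_div ?subr_eq0 1?eq_sym // => /eqP E.
have : 2%:R * (x - y) = 0 :> F.
  by rewrite (_ : _ * _ = (1 + x) * (1 - y) - (1 + y) * (1 - x)); [rewrite E subrr|ring].
by move/eqP; rewrite mulf_eq0 pnatr_eq0 /= subr_eq0 => /eqP.
Qed.

Lemma sum_icot_clear (F : fieldType) (I : finType) (P : pred I) (c y : I -> F) :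
  (forall j, P j -> y j != 1) ->
  (\sum_(j | P j) c j * icot (y j)) * \prod_(j | P j) (1 - y j) =
  \sum_(j | P j) c j * (1 + y j) * \prod_(i | P i && (i != j)) (1 - y i).
Proof.
move=> y1; rewrite mulr_suml; apply: eq_bigr => j Pj.
rewrite (bigD1 j) //= /icot; have := y1 _ Pj.
by rewrite eq_sym -subr_eq0 => nz; field.
Qed.

Lemma sum_icot_conj (F : numClosedFieldType) (I : finType) (c : I -> rat)
    (y : I -> F) (n k : nat) :
  (0 < n)%N -> coprime k n -> (forall j, y j ^+ n = 1) -> (forall j, y j != 1) ->
  \sum_j ratr (c j) * icot (y j) = 0 -> \sum_j ratr (c j) * icot (y j ^+ k) = 0.
Proof.
move=> n_gt0 kn yn y1 rel.
have [z pz] := exists_prim_root F n_gt0.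
have ex j : exists i : 'I_n, y j = z ^+ i.
  by have [i ->] := prim_rootP pz (yn j); exists i.
have [a Da] := fin_all_exists ex.
have yk1 j : y j ^+ k != 1.
  apply: contra (y1 j) => /eqP e.
  have: y j ^+ gcdn k n = 1.
    have [k0|k_gt0] := posnP k.
      by rewrite k0 gcd0n yn.
    have [u v D _] := egcdnP n k_gt0.
    have := congr1 (GRing.exp (y j)) D.
    by rewrite exprD (mulnC u) (mulnC v) !exprM e yn !expr1n mul1r.
  by rewrite (eqP kn) expr1 => ->.
(* The relation with its denominators cleared, written as a rational polynomial in the primitive
   root [z], so that [prim_root_conj] applies. *)
pose P : {poly rat} := \sum_j (c j)%:P * (1 + 'X^(a j)) *
  \prod_(i | i != j) (1 - 'X^(a i)).
have evalP x : (forall j, x ^+ a j != 1) ->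
    (pQto F P).[x] = (\sum_j ratr (c j) * icot (x ^+ a j)) * \prod_j (1 - x ^+ a j).
  move=> x1; rewrite (sum_icot_clear (P := xpredT)) //.
  rewrite rmorph_sum horner_sum; apply: eq_bigr => j _ /=.
  rewrite !rmorphM rmorphD rmorph1 /= map_polyC map_polyXn /= rmorph_prod.
  rewrite !hornerE horner_prod; congr (_ * _).
  by apply: eq_bigr => i _; rewrite rmorphB rmorph1 /= map_polyXn !hornerE.
have zka j : (z ^+ k) ^+ a j = y j ^+ k by rewrite Da -!exprM mulnC.
have : root (pQto F P) (z ^+ k).
  apply: (prim_root_conj pz kn); apply/rootP; rewrite evalP; last first.
    by move=> j; rewrite -Da.
  rewrite [X in X * _](_ : _ = \sum_j ratr (c j) * icot (y j)).
    by rewrite rel mul0r.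
  by apply: eq_bigr => j _; rewrite Da.
move/rootP; rewrite evalP; last by move=> j; rewrite zka.
rewrite [X in X * _](_ : _ = \sum_j ratr (c j) * icot (y j ^+ k)); last first.
  by apply: eq_bigr => j _; rewrite zka.
move/eqP; rewrite mulf_eq0 => /orP[/eqP //|].
rewrite prodf_seq_eq0 => /hasP[j _] /=.
by rewrite zka subr_eq0 eq_sym (negPf (yk1 j)).
Qed.

(** * Independence of the functions [icot (y * x ^ k)] of [x] *)

Lemma size_1D_monomial (R : idomainType) (a : R) (k : nat) :
  (size (1 + a *: 'X^k)%R <= k.+1)%N.
Proof.
apply: leq_trans (size_polyD _ _) _.
rewrite geq_max size_poly1 /=; apply: leq_trans (size_scale_leq _ _) _.
by rewrite size_polyXn.
Qed.

Lemma size_prod_1B_monomial (R : idomainType) (I : finType) (P : pred I)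
    (y : I -> R) (k : I -> nat) :
  (size (\prod_(i | P i) (1 - y i *: 'X^(k i)))%R <= (\sum_(i | P i) k i).+1)%N.
Proof.
elim/big_ind2: _ => [|m p n q Hp Hq|i _]; first by rewrite size_poly1.
  apply: leq_trans (size_polyMleq _ _) _; move: Hp Hq.
  by move: (size p) (size q) => a b; lia.
by rewrite -scaleNr size_1D_monomial.
Qed.

(** The cleared numerator has degree at most the sum of the [k j], and every element of [D] is a
    root of it. *)
Lemma sum_icot_clear_eq0 (F : fieldType) (I : finType) (P : pred I)
    (c y : I -> F) (k : I -> nat) (D : seq F) :
  uniq D -> (\sum_(j | P j) k j < size D)%N ->
  (forall x j, x \in D -> P j -> y j * x ^+ k j != 1) ->
  (forall x, x \in D -> \sum_(j | P j) c j * icot (y j * x ^+ k j) = 0) ->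
  \sum_(j | P j) (c j)%:P * (1 + y j *: 'X^(k j)) *
    \prod_(i | P i && (i != j)) (1 - y i *: 'X^(k i)) = 0.
Proof.
move=> uD szD y1 rel; set N := (LHS in LHS = 0).
apply: (roots_geq_poly_eq0 (rs := D)) => //; last first.
  apply: leq_trans szD; apply: leq_trans (size_sum _ _ _) _.
  apply/bigmax_leqP => j Pj.
  rewrite -mulrA mul_polyC; apply: leq_trans (size_scale_leq _ _) _.
  apply: leq_trans (size_polyMleq _ _) _; rewrite [X in (_ <= X.+1)%N](bigD1 j) //=.
  have := size_prod_1B_monomial (fun i => P i && (i != j)) y k.
  have := size_1D_monomial (y j) (k j).
  by move: (size _) (size _) (\sum_(i | _) _)%N => a b e; lia.
apply/allP => x xD; apply/rootP; rewrite -[RHS](mul0r (\prod_(j | P j) (1 - y j * x ^+ k j))).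
rewrite -(rel x xD) sum_icot_clear; last by move=> j; apply: y1.
rewrite horner_sum; apply: eq_bigr => j Pj.
rewrite !hornerE horner_prod; congr (_ * _).
by apply: eq_bigr => i _; rewrite !hornerE.
Qed.

(** Among the terms with nonzero coefficient, the one of least exponent [k j0] is isolated by
    reading the cleared numerator modulo [X^(k j0 + 1)]. *)
Lemma icot_free_exponents (F : numFieldType) (I : finType)
    (c y : I -> F) (k : I -> nat) (D : seq F) :
  uniq D -> (\sum_j k j < size D)%N ->
  injective k -> (forall j, 0 < k j)%N -> (forall j, y j != 0) ->
  (forall x j, x \in D -> y j * x ^+ k j != 1) ->
  (forall x, x \in D -> \sum_j c j * icot (y j * x ^+ k j) = 0) ->
  forall j, c j = 0.
Proof.
move=> uD szD injk k0 y0 y1 rel j1; apply/eqP; apply: contraT => cj1.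
pose P := [pred j | c j != 0].
have [j0 Pj0 minj0] := @arg_minnP _ j1 P k cj1.
have szD' : (\sum_(j | P j) k j < size D)%N.
  by apply: leq_ltn_trans szD; rewrite [X in (_ <= X)%N](bigID P) leq_addr.
have rel' x : x \in D -> \sum_(j | P j) c j * icot (y j * x ^+ k j) = 0.
  move=> xD; rewrite -[RHS](rel _ xD) [RHS](bigID P) /= [X in _ + X]big1 ?addr0 //.
  by move=> j /negPn/eqP ->; rewrite mul0r.
have := sum_icot_clear_eq0 uD szD' (fun x j xD _ => y1 x j xD) rel'.
rewrite (bigD1 j0) //=.
(* Modulo [X^(k j0 + 1)] every factor but the one of [j0] is [1]. *)
pose cong (p q : {poly F}) := 'X^((k j0).+1) %| p - q.
have congM p q r s : cong p q -> cong r s -> cong (p * r) (q * s).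
  move=> h1 h2; rewrite /cong (_ : _ - _ = (p - q) * r + q * (r - s)); last by ring.
  by apply: dvdp_add; [apply: dvdp_mulr | apply: dvdp_mull].
have congxx p : cong p p by rewrite /cong subrr dvdp0.
have congD p q r s : cong p q -> cong r s -> cong (p + r) (q + s).
  move=> h1 h2; rewrite /cong (_ : _ - _ = (p - q) + (r - s)); last by ring.
  by rewrite dvdp_add.
have kj j : P j -> j != j0 -> (k j0 < k j)%N.
  by move=> Pj jj0; rewrite ltn_neqAle minj0 // andbT eq_sym; apply: contra jj0 => /eqP/injk ->.
have cong1 a j : P j -> j != j0 -> cong (1 + a *: 'X^(k j)) 1.
  move=> Pj jj0; rewrite /cong addrC addKr -mul_polyC dvdp_mull //.
  by rewrite dvdp_Pexp2l ?size_polyX // kj.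
have congP (Q : pred I) : (forall j, Q j -> P j && (j != j0)) ->
    cong (\prod_(i | Q i) (1 - y i *: 'X^(k i))) 1.
  move=> PQ; elim/big_ind: _ => // [p q h1 h2|i /PQ /andP[Pi ij0]].
    by rewrite -[X in cong _ X]mulr1; apply: (congM _ _ _ _).
  by rewrite -scaleNr; apply: (cong1 _ _).
(* In each term with [j != j0] the only nontrivial factor left is the denominator
   [1 - y j0 X^(k j0)]; the coefficients of these terms add up to [s]. *)
pose s := \sum_(j | P j && (j != j0)) c j.
have : cong ((c j0)%:P * (1 + y j0 *: 'X^(k j0)) *
     \prod_(i | P i && (i != j0)) (1 - y i *: 'X^(k i)) +
     \sum_(j | P j && (j != j0)) (c j)%:P * (1 + y j *: 'X^(k j)) *
     \prod_(i | P i && (i != j)) (1 - y i *: 'X^(k i)))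
  ((c j0)%:P * (1 + y j0 *: 'X^(k j0)) * 1 + s%:P * (1 - y j0 *: 'X^(k j0))).
  apply: (congD _ _ _ _); first by apply: (congM _ _ _ _) => //; apply: (congP _).
  rewrite rmorph_sum mulr_suml /=.
  apply: (big_ind2 cong) => [//|p q r t hp hr|j /andP[Pj jj0]]; first exact: (congD _ _ _ _).
  rewrite -mulrA.
  apply: (congM _ _ _ _) => //; rewrite -[X in cong _ X]mul1r.
  apply: (congM _ _ _ _); first exact: (cong1 _ _).
  rewrite (bigD1 j0) /=; last by apply/andP; split; [exact: Pj0 | rewrite eq_sym].
  rewrite -[X in cong _ X]mulr1; apply: (congM _ _ _ _) => //; apply: (congP _) => i.
  by case/andP=> /andP[Pi _] ij0; apply/andP; split; [exact: Pi|].
rewrite /cong => /[swap] ->; rewrite sub0r dvdpNr => /dvdpP[G E].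
(* The coefficients of degrees 0 and [k j0] give [c j0 + s = 0] and [(c j0 - s) * y j0 = 0], hence
   [2 * c j0 * y j0 = 0]. *)
have /= := congr1 (fun p : {poly F} => p`_0) E.
have /= := congr1 (fun p : {poly F} => p`_(k j0)) E.
rewrite !coefMXn ltnSn /= mulr1 !coefD !coefCM !coefD !coefN !coefZ !coefXn !coef1.
rewrite eqxx (gtn_eqF (k0 j0)) (ltn_eqF (k0 j0)) !mulr0 !add0r !addr0 !mulr1 => E1 E0.
have : 2%:R * (c j0 * y j0) = 0.
  rewrite (_ : _ * _ = (c j0 + s) * y j0 + (c j0 * y j0 + s * - y j0)); last by ring.
  by rewrite E1; move: E0; rewrite subr0 mulr1 => ->; rewrite mul0r addr0.
move/eqP; rewrite !mulf_eq0 pnatr_eq0 (negPf (y0 j0)) orbF /= => c0.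
by move: Pj0; rewrite /= c0.
Qed.

(** The summands have poles at distinct points; evaluating the cleared numerator at the pole
    [(y j0)^-1] kills every term but that of [j0]. *)
Lemma icot_free_scalars (F : numFieldType) (I : finType)
    (c y : I -> F) (D : seq F) :
  uniq D -> (#|I| < size D)%N -> injective y -> (forall j, y j != 0) ->
  (forall x j, x \in D -> y j * x != 1) ->
  (forall x, x \in D -> \sum_j c j * icot (y j * x) = 0) ->
  forall j, c j = 0.
Proof.
move=> uD szD injy y0 y1 rel j0.
have := @sum_icot_clear_eq0 F I xpredT c y (fun=> 1%N) D uD.
rewrite sum1_card => /(_ szD) /(_ (fun x j xD _ => y1 x j xD)) /(_ rel).
move/(congr1 (horner^~ (y j0)^-1)); rewrite horner0 horner_sum (bigD1 j0) //=.
rewrite [X in _ + X]big1 ?addr0; last first.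
  move=> j jj0; rewrite (bigD1 j0) /=; last by rewrite eq_sym.
  by rewrite !hornerE /= divff // subrr !(mul0r, mulr0).
rewrite !hornerE horner_prod divff // => /eqP.
rewrite !mulf_eq0 (_ : 1 + 1 = 2%:R) // pnatr_eq0 orbF => /orP[/eqP //|].
case/prodf_eq0 => i ij0; rewrite !hornerE subr_eq0 => /eqP e.
by move: ij0; rewrite -(inj_eq injy) -[y i]mulr1 -(mulVf (y0 j0)) mulrA -e mul1r eqxx.
Qed.

(** * Roots of unity with dependent cotangents *)

Lemma count_le1 (T : eqType) (a : pred T) (s : seq T) :
  uniq s -> (forall x y, x \in s -> y \in s -> a x -> a y -> x = y) ->
  (count a s <= 1)%N.
Proof.
move=> us a1; rewrite -size_filter.
have := filter_uniq a us; case E: (filter a s) => [|x [|y t]] //=.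
have xs : x \in filter a s by rewrite E mem_head.
have ys : y \in filter a s by rewrite E in_cons mem_head orbT.
move: xs ys; rewrite !mem_filter => /andP[ax xs] /andP[ay ys].
by rewrite (a1 x y) // in_cons eqxx.
Qed.

Lemma size_le_fibers (T1 T2 : eqType) (f : T1 -> T2) (n : nat) (t : seq T2)
    (s : seq T1) :
  (forall x, x \in s -> f x \in t) ->
  (forall b, b \in t -> (count (fun x => f x == b) s <= n)%N) ->
  (size s <= n * size t)%N.
Proof.
elim: t s => [|b t IH] s st cs.
  by case: s st {cs} => [|x s] // /(_ x (mem_head _ _)).
rewrite /= mulnS -(count_predC (fun x => f x == b)) leq_add ?cs ?mem_head //.
rewrite -size_filter; apply: IH => [x|b' b't].
  by rewrite mem_filter => /andP[/= nb /st]; rewrite in_cons (negPf nb).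
rewrite count_filter; apply: leq_trans (cs b' _); last by rewrite in_cons b't orbT.
by apply: sub_count => x /= /andP[].
Qed.

(* [1800 = 2^3 * 3^2 * 5^2]: an excess prime power in [m] yields [p ^ f = 8], [9], [25]
   or a prime [p >= 7]. *)
Lemma exists_prime_power (m : nat) :
  (0 < m)%N -> ~~ (m %| 1800)%N -> exists p f : nat,
  [/\ prime p, (0 < f)%N, (7 <= p ^ f)%N & (p ^ f %| m)%N] /\
  [/\ ((p * p ^ f %| m) || (p ^ f == p))%N & ((p ^ f <= 25) || (p ^ f == p))%N].
Proof.
move=> m0 /(dvdn_partP _ m0) nd.
have [p pm np] : exists2 p, p \in \pi(m) & ~~ (m`_p %| 1800)%N.
  apply/hasP; apply: contraT; rewrite -all_predC => /allP h; case: nd => p pm.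
  by have := h p pm; rewrite /= negbK.
have pp : prime p by move: pm; rewrite mem_primes => /andP[].
have pdm : (p %| m)%N by move: pm; rewrite mem_primes => /and3P[].
have [e Ee] : exists e, (m`_p = p ^ e)%N by exists (logn p m); rewrite p_part.
have em : (p ^ e %| m)%N by rewrite -Ee dvdn_part.
have small f : (p ^ f %| 1800)%N -> (p ^ f.+1 %| m)%N.
  move=> hf; apply: dvdn_trans em; rewrite dvdn_exp2l // ltnNge.
  by apply: contra np => ef; rewrite Ee; apply: dvdn_trans hf; rewrite dvdn_exp2l.
have [p7|p7] := leqP 7 p.
  by exists p, 1%N; rewrite expn1 eqxx !orbT.
have : p \in [:: 2; 3; 5]%N.
  by move: p p7 pp {pm np pdm Ee em small}; do 7![case=> //].
rewrite !inE => /or3P[] /eqP E; rewrite {}E in pp small *.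
- by exists 2%N, 3%N; split; split=> //; [exact: (small 2%N)|rewrite -expnS small].
- by exists 3%N, 2%N; split; split=> //; [exact: (small 1%N)|rewrite -expnS small].
- by exists 5%N, 2%N; split; split=> //; [exact: (small 1%N)|rewrite -expnS small].
Qed.

(** With [q = p ^ f], a prime dividing both [1 + (m / q) h i] and [m] cannot divide [m / q], so it
    is [p], and [p] does not divide [m / q]. This excludes [p q] dividing [m]; if [q = p], it
    happens for at most one [i] modulo [p]. *)
Lemma count_coprime_progression (p f m h : nat) :
  prime p -> (0 < f)%N -> (0 < m)%N -> (p ^ f %| m)%N ->
  ((p * p ^ f %| m) || (p ^ f == p))%N -> coprime h (p ^ f) ->
  ((p ^ f).-1 <=
   count (fun i => coprime (1 + (m %/ p ^ f) * (h * i)) m) (iota 0 (p ^ f)))%N.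
Proof.
set q := (p ^ f)%N => pp f0 m0 qm pqm hq.
set a := (fun i : nat => _).
suff : (count (predC a) (iota 0 q) <= 1)%N.
  by have := count_predC a (iota 0 q); rewrite size_iota; lia.
have Dm : m = (m %/ q * q)%N by rewrite divnK.
have bad i : ~~ a i -> (p %| 1 + (m %/ q) * (h * i))%N /\ q = p.
  move=> nai; have g1 : gcdn (1 + (m %/ q) * (h * i)) m != 1%N by [].
  pose r := pdiv (gcdn (1 + (m %/ q) * (h * i)) m).
  have pr : prime r by rewrite pdiv_prime // ltn_neqAle eq_sym g1 gcdn_gt0 m0 orbT.
  have := pdiv_dvd (gcdn (1 + (m %/ q) * (h * i)) m); rewrite -/r dvdn_gcd => /andP[r1 rm].
  have rnq : ~~ (r %| m %/ q)%N.
    apply/negP => rq; move: r1; rewrite dvdn_addl ?dvdn_mulr // dvdn1 => /eqP r1.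
    by rewrite r1 in pr.
  have rp : r = p.
    move: rm; rewrite Dm Euclid_dvdM // (negPf rnq) /= Euclid_dvdX // => /andP[rp _].
    by apply/eqP; rewrite -dvdn_prime2.
  rewrite -rp; split=> //; rewrite rp.
  case/orP: pqm => [pq|/eqP //]; case/negP: rnq; rewrite rp.
  by move: pq; rewrite {1}Dm dvdn_pmul2r // /q expn_gt0 prime_gt0.
apply: count_le1; first exact: iota_uniq.
move=> i j; rewrite !mem_iota !add0n /= => iq jq.
wlog ij : i j iq jq / (i <= j)%N.
  by move=> H hi hj; case/orP: (leq_total i j) => ij; [|symmetry]; apply: H.
move=> /bad[hi qp] /bad[hj _]; apply/eqP; rewrite eqn_leq ij /= leqNgt; apply/negP => ltij.
have pmq : coprime p (m %/ q).
  rewrite prime_coprime //; apply/negP => pmq; move: hi.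
  by rewrite dvdn_addl ?dvdn_mulr // dvdn1 => /eqP p1; rewrite p1 in pp.
have : (p %| (1 + (m %/ q) * (h * j)) - (1 + (m %/ q) * (h * i)))%N by rewrite dvdn_sub.
rewrite subnDl -mulnBr -mulnBr Gauss_dvdr // Gauss_dvdr; last by rewrite coprime_sym -qp.
by move/dvdn_leq => /(_ _); rewrite subn_gt0 => /(_ ltij); lia.
Qed.

(** With [q = p ^ f], raising [y j] to the power [1 + (m / q) h i] multiplies it by [x ^ k' j],
    where [x = z ^ i]. [D] collects the [x] for which this power is coprime to [m]; the choice of
    [h] rescales the exponents modulo [q]. *)
Lemma icot_relation_orbit (F : numClosedFieldType) (I : finType) (c : I -> rat) (y : I -> F)
    (p f m h : nat) (z : F) (k k' : I -> nat) :
  prime p -> (0 < f)%N -> (0 < m)%N -> (p ^ f %| m)%N ->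
  ((p * p ^ f %| m) || (p ^ f == p))%N -> coprime h (p ^ f) ->
  (p ^ f).-primitive_root z ->
  (forall j, y j ^+ m = 1) -> (forall j, y j != 1) ->
  (forall j, y j ^+ (m %/ p ^ f) = z ^+ k j) ->
  (forall j, k' j = h * k j %[mod p ^ f]) ->
  \sum_j ratr (c j) * icot (y j) = 0 ->
  exists D : seq F, [/\ uniq D, ((p ^ f).-1 <= size D)%N,
    (forall x j, x \in D -> y j * x ^+ k' j != 1) &
    (forall x, x \in D -> \sum_j ratr (c j) * icot (y j * x ^+ k' j) = 0)].
Proof.
move=> pp f0 m0 qm pqm hq; have := count_coprime_progression pp f0 m0 qm pqm hq.
set q := (p ^ f)%N => cnt pz ym y1 yk kk' rel.
set a := (fun i : nat => coprime _ _) in cnt.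
exists [seq z ^+ i | i <- iota 0 q & a i].
have Dx x : x \in [seq z ^+ i | i <- iota 0 q & a i] -> exists2 e, coprime e m &
    forall j, y j * x ^+ k' j = y j ^+ e.
  case/mapP=> i; rewrite mem_filter => /andP[ai _] ->; exists (1 + (m %/ q) * (h * i))%N => // j.
  rewrite exprD expr1 exprM yk -!exprM; congr (_ * _); apply/eqP.
  rewrite (eq_prim_root_expr pz) -modnMmr kk' modnMmr; apply/eqP; congr (_ %% _)%N.
  by ring.
split.
- rewrite map_inj_in_uniq ?filter_uniq ?iota_uniq // => i j.
  rewrite !mem_filter !mem_iota !add0n /= => /andP[_ iq] /andP[_ jq] /eqP.
  by rewrite (eq_prim_root_expr pz) !modn_small // => /eqP.
- by rewrite size_map size_filter.
- move=> x j /Dx[e em ->]; apply: contra (y1 j) => /eqP ye.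
  have [e0|e_gt0] := posnP e.
    by move: em; rewrite e0 /coprime gcd0n => /eqP m1; rewrite -(expr1 (y j)) -m1 ym.
  have [u v D _] := egcdnP m e_gt0.
  have := congr1 (GRing.exp (y j)) D.
  by rewrite (eqP em) exprD (mulnC u) (mulnC v) !exprM ye ym !expr1n mul1r expr1 => <-.
- move=> x /Dx[e em E]; under eq_bigr do rewrite E.
  exact: (sum_icot_conj m0 em).
Qed.

(** Equivalently, the cotangents span a [Q]-space of dimension less than [d]: repetitions in [y] are
    allowed but give trivial relations. For [d = 0] the condition never holds. *)
Definition icot_dependent (F : numClosedFieldType) (d : nat) (s : seq F) :=
  forall y : 'I_d -> F, (forall j, y j \in s) ->
  exists c : 'I_d -> rat, (exists j, c j != 0) /\
    \sum_j ratr (c j) * icot (y j) = 0.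

Lemma icot_dependentW (F : numClosedFieldType) (d : nat) (s t : seq F) :
  {subset s <= t} -> icot_dependent d t -> icot_dependent d s.
Proof. by move=> st dt y ys; apply: dt => j; apply: st. Qed.

(** Taking [h] to be an inverse [u] of [k] modulo [p ^ f] turns all exponents into 1; then [D] has
    at least 6 elements, more than the four terms of a relation. *)
Lemma size_icot_dependent_fiber (F : numClosedFieldType) (p f m k : nat) (z : F) (s : seq F) :
  prime p -> (0 < f)%N -> (0 < m)%N -> (p ^ f %| m)%N ->
  ((p * p ^ f %| m) || (p ^ f == p))%N -> (7 <= p ^ f)%N ->
  (p ^ f).-primitive_root z -> coprime k (p ^ f) ->
  (forall y, y \in s -> [/\ y ^+ m = 1, y != 1 & y ^+ (m %/ p ^ f) = z ^+ k]) ->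
  uniq s -> icot_dependent 4 s -> (size s <= 3)%N.
Proof.
move=> pp f0 m0 qm pqm q7 pz kq hs us dep; rewrite leqNgt; apply/negP => s4.
pose y (j : 'I_4) := nth 1 s j.
have sj (j : 'I_4) : (j < size s)%N by apply: leq_trans s4.
have ys j : y j \in s by apply: mem_nth.
have [c [[j0 cj0] rel]] := dep y ys.
have k0 : (0 < k)%N.
  rewrite lt0n; apply/negP => /eqP k0; move: kq; rewrite k0 /coprime gcd0n.
  by move/eqP => q1; rewrite q1 in q7.
have [u v D _] := egcdnP (p ^ f) k0; rewrite (eqP kq) in D.
have uk : (u * k = 1 %[mod p ^ f])%N by rewrite D modnMDl.
have uq : coprime u (p ^ f).
  have : coprime (u * k) (p ^ f) by rewrite -coprime_modl uk coprime_modl coprime1n.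
  by rewrite coprimeMl => /andP[].
have y0 j : y j != 0.
  have [ym _ _] := hs _ (ys j); apply/eqP => y0.
  by move/eqP: ym; rewrite y0 expr0n eqn0Ngt m0 eq_sym oner_eq0.
have [D' [uD szD h1 h2]] := @icot_relation_orbit F _ c y p f m u z (fun=> k) (fun=> 1%N) pp f0 m0 qm pqm uq pz
  (fun j => let: And3 a _ _ := hs _ (ys j) in a) (fun j => let: And3 _ a _ := hs _ (ys j) in a)
  (fun j => let: And3 _ _ a := hs _ (ys j) in a) (fun=> esym uk) rel.
have := @icot_free_scalars F _ (fun j => ratr (c j)) y D' uD _ _ y0 h1 h2 j0.
rewrite card_ord => /(_ _ _)/eqP; rewrite fmorph_eq0 (negPf cj0) => H; apply: notF; apply: H.
  by apply: leq_trans szD; rewrite -ltnS prednK; apply: leq_trans q7.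
move=> i j /eqP; rewrite nth_uniq // => /eqP; exact: val_inj.
Qed.

Lemma icot_spread_absurd (F : numClosedFieldType) (p m h : nat) (z : F) (y : 'I_4 -> F)
    (k : 'I_4 -> nat) (s : seq F) :
  prime p -> (0 < m)%N -> (p %| m)%N -> coprime h p -> p.-primitive_root z ->
  (forall j, [/\ y j \in s, y j ^+ m = 1, y j != 1 & y j ^+ (m %/ p) = z ^+ k j]) ->
  (forall j, 0 < k j < p)%N -> (forall j, 4 * ((h * k j) %% p) < p)%N ->
  injective k -> icot_dependent 4 s -> False.
Proof.
move=> pp m0 pm hp pz hy kp k4 injk dep.
have ys j : y j \in s by have [] := hy j.
have [c [[j0 cj0] rel]] := dep y ys.
pose k' (j : 'I_4) := ((h * k j) %% p)%N.
have ym j : y j ^+ m = 1 by have [] := hy j.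
have y1 j : y j != 1 by have [] := hy j.
have yk j : y j ^+ (m %/ p) = z ^+ k j by have [] := hy j.
have y0 j : y j != 0.
  apply/eqP => y0.
  by move/eqP: (ym j); rewrite y0 expr0n eqn0Ngt m0 eq_sym oner_eq0.
have kk' j : k' j = (h * k j)%N %[mod p] by rewrite modn_mod.
have := @icot_relation_orbit F _ c y p 1 m h z k k' pp isT m0.
rewrite !expn1 eqxx orbT => /(_ pm isT hp pz ym y1 yk kk' rel)[D [uD szD h1 h2]].
have k'0 j : (0 < k' j)%N.
  rewrite lt0n -/(dvdn p _) Gauss_dvdr; last by rewrite coprime_sym.
  by case/andP: (kp j) => a b; rewrite gtnNdvd.
have injk' : injective k'.
  move=> i j e; apply: injk; move: (kp i) (kp j) => /andP[_ ip] /andP[_ jp].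
  move: e ip jp; rewrite /k'; move: (k i) (k j) => a b /eqP.
  wlog ab : a b / (b <= a)%N.
    move=> H; case/orP: (leq_total b a) => ab; first exact: H.
    by rewrite eq_sym => e ha hb; symmetry; exact: H.
  rewrite eqn_mod_dvd ?leq_mul // -mulnBr Gauss_dvdr 1?coprime_sym // => pd ap bp.
  apply/eqP; rewrite eqn_leq ab andbT leqNgt; apply/negP => ba.
  by move/dvdn_leq: pd; rewrite subn_gt0 => /(_ ba); lia.
have szk : (\sum_j k' j < size D)%N.
  apply: leq_trans szD; rewrite !big_ord_recl big_ord0 /=.
  move: (k4 ord0) (k4 (lift ord0 ord0)) (k4 (lift ord0 (lift ord0 ord0)))
    (k4 (lift ord0 (lift ord0 (lift ord0 ord0)))); rewrite -!/(k' _).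
  (* Each exponent is at most [(p - 1) / 4]. Since [D] may have only [p - 1] elements, the sum must
     be strictly below [p - 1], which holds because two exponents differ. *)
  have : k' ord0 != k' (lift ord0 ord0) by rewrite (inj_eq injk').
  have := prime_gt1 pp.
  move: (k' _) (k' _) (k' _) (k' _) => a1 a2 a3 a4; lia.
have := @icot_free_exponents F _ (fun j => ratr (c j)) y k' D uD szk injk' k'0 y0 h1 h2 j0.
by move/eqP; rewrite fmorph_eq0 (negPf cj0).
Qed.

(** These represent 1, 2, 3, -1, -2, -3 modulo [p]. *)
Definition small_multipliers (p : nat) : seq nat := [:: 1; 2; 3; p - 1; p - 2; p - 3]%N.

(** The interval of values [k / p] is cut at 1/4, 1/3, 3/8, 1/2, 5/8, 2/3 and 3/4, with one
    multiplier for each piece. Oddness of [p] excludes equality at the cuts where the bound would be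
    attained. *)
Lemma small_multiplierP (p k : nat) :
  (4 < p)%N -> odd p -> (0 < k < p)%N ->
  has (fun h => 4 * ((h * k) %% p) < p)%N (small_multipliers p).
Proof.
move=> p4 op kp; rewrite /=.
have md q r : (r < p)%N -> ((q * p + r) %% p = r)%N by move=> rp; rewrite modnMDl modn_small.
have E (h q r : nat) : (h * k = q * p + r)%N -> (4 * r < p)%N -> (4 * ((h * k) %% p) < p)%N.
  by move=> -> rp; rewrite md //; lia.
have E' (h q : nat) : (h < p)%N -> (h * k <= q * p)%N -> (q <= k)%N ->
    (4 * (q * p - h * k) < p)%N -> (4 * (((p - h) * k) %% p) < p)%N.
  move=> hp hq qk; apply: (E _ (k - q)%N); rewrite !mulnBl.
  by have := leq_mul qk (leqnn p); rewrite (mulnC p k); lia.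
have [a Da] : exists a, p = (2 * a).+1 by exists p./2; lia.
have [c1|c1] := ltnP (4 * k) p; first by rewrite (E 1%N 0%N k) //; lia.
have [c2|c2] := ltnP (4 * (p - k)) p.
  by rewrite (E' 1%N 1%N) ?orbT //; lia.
have [c3|c3] := ltnP (8 * k) (3 * p).
  have [c4|c4] := ltnP (3 * k) p.
    by rewrite (E' 3%N 1%N) ?orbT //; lia.
  by rewrite (E 3%N 1%N (3 * k - p)%N) ?orbT //; lia.
have [c4|c4] := ltnP (2 * k) p.
  by rewrite (E' 2%N 1%N) ?orbT //; lia.
have [c5|c5] := ltnP (8 * k) (5 * p).
  by rewrite (E 2%N 1%N (2 * k - p)%N) ?orbT //; lia.
have [c6|c6] := ltnP (3 * k) (2 * p).
  by rewrite (E' 3%N 2%N) ?orbT //; lia.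
by rewrite (E 3%N 2%N (3 * k - 2 * p)%N) ?orbT //; lia.
Qed.

Lemma coprime_small_multipliers (p h : nat) :
  prime p -> (3 < p)%N -> h \in small_multipliers p -> coprime h p.
Proof.
move=> pp p3 hs; rewrite coprime_sym prime_coprime // gtnNdvd //.
  by move: hs; rewrite !inE; lia.
by move: hs; rewrite !inE; lia.
Qed.

(* Each exponent [k] with [y ^ (m / q) = z ^ k] comes from at most 3 elements. There are at
   most 25 exponents if [q <= 25], and otherwise at most 3 for each of the 6 multipliers
   [h] making [h * k mod p] smaller than [p / 4]. *)
Lemma size_icot_dependent_top (F : numClosedFieldType) (p f m : nat) (s : seq F) :
  prime p -> (0 < f)%N -> (0 < m)%N -> (p ^ f %| m)%N ->
  ((p * p ^ f %| m) || (p ^ f == p))%N -> (7 <= p ^ f)%N ->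
  ((p ^ f <= 25) || (p ^ f == p))%N ->
  (forall y, y \in s -> [/\ y ^+ m = 1, y != 1 & y ^+ (m %/ p) != 1]) ->
  uniq s -> icot_dependent 4 s -> (size s <= 75)%N.
Proof.
move=> pp f0 m0 qm pqm q7 small hs us dep.
have q0 : (0 < p ^ f)%N by apply: leq_trans q7.
have [z pz] := exists_prim_root F q0.
pose k (y : F) := index (y ^+ (m %/ p ^ f)) [seq z ^+ i | i <- iota 0 (p ^ f)].
have kP y : y \in s ->
    [/\ (k y < p ^ f)%N, y ^+ (m %/ p ^ f) = z ^+ k y & coprime (k y) (p ^ f)].
  move=> /hs[ym _ yp].
  have yin : y ^+ (m %/ p ^ f) \in [seq z ^+ i | i <- iota 0 (p ^ f)].
    have : (y ^+ (m %/ p ^ f)) ^+ (p ^ f) = 1 by rewrite -exprM divnK.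
    by case/(prim_rootP pz) => i ->; apply/mapP; exists (val i); rewrite // mem_iota /=.
  have kq : (k y < p ^ f)%N by move: yin; rewrite -index_mem size_map size_iota.
  have ky : y ^+ (m %/ p ^ f) = z ^+ k y.
    have := nth_index 0 yin; rewrite (nth_map 0%N) ?size_iota // nth_iota //.
  split=> //; rewrite coprime_pexpr // coprime_sym prime_coprime //.
  (* [y ^ (m / p)] is the power [p ^ (f - 1)] of [z ^ k y], so it would be 1 if [p] divided
     [k y]. *)
  apply: contra yp => /dvdnP[a ka]; apply/eqP.
  have -> : (m %/ p = m %/ p ^ f * p ^ f.-1)%N.
    rewrite -{1}(divnK qm) -{2}(prednK f0) expnSr mulnA mulnK //.
    exact: prime_gt0.
  rewrite exprM ky ka -!exprM -mulnA -expnS prednK // mulnC exprM.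
  by rewrite (prim_expr_order pz) expr1n.
have fib b : (count (fun y => k y == b) s <= 3)%N.
  rewrite -size_filter; set t := filter _ s.
  have ts : {subset t <= s} by move=> y; rewrite mem_filter => /andP[].
  case: (posnP (size t)) => [-> //|]; rewrite -has_predT => /hasP[y0 y0t _].
  have bq : coprime b (p ^ f).
    have [_ _] := kP _ (ts _ y0t).
    by move: y0t; rewrite mem_filter => /andP[/eqP ->].
  apply: (size_icot_dependent_fiber pp f0 m0 qm pqm q7 pz bq).
  - move=> y yt; have [ym y1 _] := hs _ (ts _ yt); have [_ yk _] := kP _ (ts _ yt).
    by split=> //; move: yt; rewrite mem_filter => /andP[/eqP <-].
  - exact: filter_uniq.
  - exact: icot_dependentW dep.
have sz := size_le_fibers (f := k) (n := 3) (t := undup (map k s)) (s := s).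
apply: leq_trans (sz _ (fun b _ => fib b)) _ => [y ys|]; first by rewrite mem_undup map_f.
suff : (size (undup (map k s)) <= 25)%N by move=> h; rewrite (leq_mul (leqnn 3) h).
have [q25|q25] := leqP (p ^ f) 25.
  apply: leq_trans q25; rewrite -[X in (_ <= X)%N](size_iota 0).
  apply: uniq_leq_size; first exact: undup_uniq.
  by move=> b; rewrite mem_undup mem_iota => /mapP[y ys ->]; have [] := kP y ys.
move: small; rewrite leqNgt q25 /= => /eqP qp.
rewrite qp in qm q7 pz kP q25 *.
have podd : odd p by case: (even_prime pp) => // p2; rewrite p2 in q7.
have k0 y : y \in s -> (0 < k y < p)%N.
  move=> /kP[kq _ cop]; rewrite kq andbT lt0n; apply/negP => /eqP ky0.
  by move: cop; rewrite ky0 /coprime gcd0n => /eqP p1; rewrite p1 in pp.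
pose hk (b : nat) := nth 0%N (small_multipliers p)
  (find (fun h => 4 * ((h * b) %% p) < p)%N (small_multipliers p)).
have hkP b : b \in undup (map k s) ->
    (hk b \in small_multipliers p) && (4 * ((hk b * b) %% p) < p)%N.
  rewrite mem_undup => /mapP[y ys ->].
  have hh := small_multiplierP (leq_trans (isT : 4 < 7)%N q7) podd (k0 y ys).
  apply/andP; split; first by apply: mem_nth; rewrite -has_find.
  by have := nth_find 0%N hh.
have := size_le_fibers (f := hk) (n := 3) (t := small_multipliers p) (s := undup (map k s)).
move=> H; apply: leq_trans (H _ _) _ => // [b /hkP/andP[] //|h hin].
rewrite leqNgt -size_filter; apply/negP => t4.
set t := filter _ _ in t4.
have ut : uniq t by rewrite filter_uniq // undup_uniq.
have tin (j : 'I_4) : nth 0%N t j \in t by apply: mem_nth; apply: leq_trans t4.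
have ex (j : 'I_4) : exists y, y \in s /\ k y = nth 0%N t j.
  have := tin j; rewrite mem_filter mem_undup => /andP[_ /mapP[y ys ->]]; by exists y.
have [y hy] := fin_all_exists ex.
apply: (@icot_spread_absurd F p m h z y (fun j => k (y j)) s pp m0 qm) => //.
- by apply: coprime_small_multipliers hin => //; apply: leq_trans q7.
- move=> j; have [ys _] := hy j; have [ym y1 _] := hs _ ys; have [_ yk _] := kP _ ys.
  by split=> //; rewrite -yk qp.
- by move=> j; apply: k0; have [] := hy j.
- move=> j; have [_ ->] := hy j; have := tin j; rewrite mem_filter => /andP[/eqP {1}<- /hkP].
  by case/andP.
- move=> i j; have [_ ->] := hy i; have [_ ->] := hy j => /eqP.
  by rewrite nth_uniq // ?(leq_trans _ t4) // => /eqP; exact: val_inj.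
Qed.

Lemma icot_dependent_lower (F : numClosedFieldType) (d p m : nat) (s : seq F) (y0 : F) :
  prime p -> (0 < m)%N -> (p %| m)%N -> (2 < p)%N || (p * p %| m)%N ->
  (forall y, y \in s -> y ^+ m = 1 /\ y != 1) ->
  y0 \in s -> y0 ^+ (m %/ p) != 1 ->
  icot_dependent d.+1 s -> icot_dependent d [seq y <- s | y ^+ (m %/ p) == 1].
Proof.
move=> pp m0 pm p2 hs y0s y0p dep y yt.
have ys j : y j \in s by move: (yt j); rewrite mem_filter => /andP[].
have yp j : y j ^+ (m %/ p) = 1 by move: (yt j); rewrite mem_filter => /andP[/eqP].
pose Y (j : 'I_d.+1) := if unlift ord0 j is Some i then y i else y0.
have Y0 : Y ord0 = y0 by rewrite /Y unlift_none.
have YS i : Y (lift ord0 i) = y i by rewrite /Y liftK.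
have Ys j : Y j \in s by rewrite /Y; case: unliftP => [i _|_].
have [c [[j0 cj0] rel]] := dep Y Ys.
(* If [p * p] divides [m], then [i = 1] works. Otherwise [p > 2], and at least [p - 1 >= 2] of the
   values [0, ..., p - 1] are suitable, so one of them is nonzero. *)
have [i ip ci] : exists2 i, (0 < i < p)%N & coprime (1 + (m %/ p) * i) m.
  have [pp2|pp2] := boolP (p * p %| m)%N.
    exists 1%N; first by rewrite prime_gt1.
    rewrite muln1; have pmp : (p %| m %/ p)%N by rewrite dvdn_divRL.
    have c1 : coprime (1 + m %/ p) (m %/ p) by rewrite add1n coprimeSn.
    rewrite -{2}(divnK pm) coprimeMr c1 /=.
    exact: coprime_dvdr pmp c1.
  move: p2; rewrite (negPf pp2) orbF => p2.
  have := @count_coprime_progression p 1 m 1 pp isT m0.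
  rewrite expn1 eqxx orbT coprime1n => /(_ pm isT isT).
  case: p p2 {pp pm pp2 y0p yp yt} => // p p2 /=.
  set a := (fun i : nat => coprime _ _) => cnt.
  have : has a (iota 1 p) by rewrite has_count; move: cnt; case: (a 0%N) => /=; lia.
  by case/hasP=> i; rewrite mem_iota => ip ai; exists i; [lia|move: ai; rewrite /a mul1n].
have := sum_icot_conj m0 ci (fun j => (hs _ (Ys j)).1) (fun j => (hs _ (Ys j)).2) rel.
move: rel; rewrite !big_ord_recl /= Y0.
under eq_bigr do rewrite YS; move=> rel.
under eq_bigr do rewrite YS exprD expr1 exprM yp expr1n mulr1.
move/eqP; rewrite -[X in _ == X]rel (inj_eq (addIr _)) => /eqP E.
(* The conjugation fixes every [y j], so comparing both relations leaves only the [y0] term. If it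
   fixed [y0] too, [y0 ^ (m / p)] would have order dividing both [i] and [p], hence be 1. *)
have c0 : c ord0 = 0.
  apply/eqP; rewrite -(fmorph_eq0 (ratr : rat -> F)); apply: contraT => c0.
  have [y0m y01] := hs _ y0s.
  have y0k : y0 ^+ (1 + m %/ p * i) != 1.
    apply: contra y01 => /eqP y0e.
    have [u v D _] := @egcdnP (1 + m %/ p * i) m (ltn0Sn _).
    have := congr1 (GRing.exp y0) D.
    by rewrite (eqP ci) exprD (mulnC u) (mulnC v) !exprM y0e y0m !expr1n mul1r expr1 => <-.
  have := icot_inj y0k y01 (mulfI c0 E).
  rewrite exprD expr1 exprM -[X in _ = X]mulr1 => /mulfI e.
  have y00 : y0 != 0 by apply/eqP => y00; move/eqP: y0m; rewrite y00 expr0n eqn0Ngt m0 eq_sym oner_eq0.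
  have xi := e y00.
  have xp : (y0 ^+ (m %/ p)) ^+ p = 1 by rewrite -exprM divnK.
  have cip : coprime i p by rewrite coprime_sym prime_coprime // gtnNdvd //; case/andP: ip.
  have i0 : (0 < i)%N by case/andP: ip.
  have [u v D _] := @egcdnP i p i0.
  have := congr1 (GRing.exp (y0 ^+ (m %/ p))) D.
  rewrite (eqP cip) exprD (mulnC u) (mulnC v) (exprM _ i) (exprM _ p) xi xp !expr1n mul1r expr1.
  by move/esym/eqP; rewrite (negPf y0p).
exists (fun j => c (lift ord0 j)); split.
  case: (unliftP ord0 j0) cj0 => [j -> cj|->]; first by exists j.
  by rewrite c0 eqxx.
by move: rel; rewrite c0 rmorph0 mul0r add0r.
Qed.

(** Induction on [d], then on [m]. If all [y ^ (m / p)] are 1, then [m] drops to [m / p]; otherwise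
    at most 75 elements are removed and the rest satisfy the condition for one less. The condition
    for 4 is carried along to give the 75 each time. *)
Lemma size_icot_dependent (F : numClosedFieldType) (d m : nat) (s : seq F) :
  (0 < m)%N -> (forall y, y \in s -> y ^+ m = 1 /\ y != 1) -> uniq s ->
  icot_dependent 4 s -> icot_dependent d s -> (size s <= 1800 + 75 * d)%N.
Proof.
elim: d m s => [|d IHd].
  move=> m s _ _ _ _ dep; have [j|c [[j _] _]] := dep (fun=> 0); by case: j.
elim/ltn_ind => m IHm s m0 hs us dep4 depd.
have [m1800|] := boolP (m %| 1800)%N.
  apply: leq_trans (leq_addr _ _).
  apply: max_unity_roots => //; apply/allP => y /hs[ym _].
  by apply/unity_rootP; rewrite -(divnK m1800) mulnC exprM ym expr1n.
case/(exists_prime_power m0) => p [f [[pp f0 q7 qm] [pqm small]]].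
have pm : (p %| m)%N by apply: dvdn_trans qm; rewrite dvdn_exp.
pose a (y : F) := y ^+ (m %/ p) == 1.
have [aT|] := boolP (all a s).
  apply: (IHm (m %/ p)%N) => //.
  - by rewrite ltn_Pdiv // prime_gt1.
  - by rewrite divn_gt0 ?prime_gt0 // dvdn_leq.
  - by move=> y ys; have [_ y1] := hs y ys; split=> //; apply/eqP; exact: (allP aT).
rewrite -has_predC => /hasP[y0 y0s /= y0p].
have sub b : {subset filter b s <= s} by move=> y; rewrite mem_filter => /andP[].
have szT : (size (filter (predC a) s) <= 75)%N.
  apply: (size_icot_dependent_top pp f0 m0 qm pqm q7 small).
  - by move=> y; rewrite mem_filter => /andP[/= ya /hs[]].
  - exact: filter_uniq.
  - exact: icot_dependentW dep4.
have p2 : (2 < p)%N || (p * p %| m)%N.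
  case/orP: pqm => [pqm|/eqP qp]; last by rewrite -qp (leq_trans _ q7).
  by rewrite (dvdn_trans _ pqm) ?orbT // dvdn_mul // dvdn_exp.
have szS : (size (filter a s) <= 1800 + 75 * d)%N.
  apply: (IHd m) => //; first by move=> y /sub/hs.
  - exact: filter_uniq.
  - exact: icot_dependentW dep4.
  - exact: (icot_dependent_lower pp m0 pm p2 hs y0s y0p depd).
by have := count_predC a s; move: szT szS; rewrite !size_filter => ? ? <-; lia.
Qed.

(** * Counting the angles of a space *)

Lemma icot_inv (F : numFieldType) (y : F) :
  y != 1 -> (icot y - 1) / (icot y + 1) = y.
Proof.
rewrite eq_sym -subr_eq0 => y1; rewrite /icot.
have n2 : 2%:R != 0 :> F by rewrite pnatr_eq0.
have -> : (1 + y) / (1 - y) - 1 = 2%:R * y / (1 - y) by field.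
have -> : (1 + y) / (1 - y) + 1 = 2%:R / (1 - y) by field.
by field; rewrite y1.
Qed.

Lemma rat_row_relation (n d : nat) (A : 'M[rat]_(n, d)) :
  (d < n)%N -> exists v : 'rV[rat]_n, v != 0 /\ v *m A = 0.
Proof.
move=> dn; have : kermx A != 0.
  by rewrite kermx_eq0 /row_free neq_ltn (leq_ltn_trans (rank_leq_col A)).
by case/rowV0Pn => v /sub_kermxP vA v0; exists v.
Qed.

Lemma exists_common_order (F : fieldType) (s : seq F) :
  (forall y, y \in s -> exists2 n, (0 < n)%N & y ^+ n = 1) ->
  exists2 m, (0 < m)%N & forall y, y \in s -> y ^+ m = 1.
Proof.
elim: s => [|x s IH] hs; first by exists 1%N.
have [|m m0 hm] := IH; first by move=> y ys; apply: hs; rewrite in_cons ys orbT.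
have [n n0 xn] := hs x (mem_head _ _).
exists (n * m)%N; first by rewrite muln_gt0 n0.
move=> y; rewrite in_cons => /orP[/eqP ->|/hm ym].
  by rewrite exprM xn expr1n.
by rewrite mulnC exprM ym expr1n.
Qed.

(** [g] inverts [icot]. Four elements have coordinates forming a 4 by 3 rational matrix, and a
    nonzero vector in its left kernel is a dependence relation. *)
Lemma size_icot_span (F : numClosedFieldType) (E : 'I_3 -> F) (s : seq F) :
  uniq s ->
  (forall t, t \in s -> exists y n, [/\ y != 1, (0 < n)%N, y ^+ n = 1 & t = icot y]) ->
  (forall t, t \in s -> exists a : 'I_3 -> rat, t = \sum_j ratr (a j) * E j) ->
  (size s <= 1800 + 75 * 4)%N.
Proof.
move=> us rt sp.
pose g (t : F) := (t - 1) / (t + 1).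
have gP t : t \in s -> [/\ exists2 n, (0 < n)%N & g t ^+ n = 1, g t != 1 & icot (g t) = t].
  case/rt=> y [n [y1 n0 yn ->]]; rewrite /g icot_inv //; split=> //; by exists n.
have [y|m m0 hm] := @exists_common_order F [seq g t | t <- s].
  by case/mapP=> t /gP[h _ _] ->.
rewrite -(size_map g); have dep : icot_dependent 4 [seq g t | t <- s].
  move=> y ys.
  have ex j : exists a : 'I_3 -> rat, icot (y j) = \sum_i ratr (a i) * E i.
    by have /mapP[t ts ->] := ys j; have [_ _ ->] := gP t ts; apply: sp.
  have [a ha] := fin_all_exists ex.
  have [v [v0 vA]] := @rat_row_relation 4 3 (\matrix_(j < 4, i < 3) a j i) isT.
  exists (v ord0); split.
    by case/rV0Pn: v0 => j vj; exists j.
  under eq_bigr do rewrite ha mulr_sumr.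
  rewrite exchange_big /= big1 // => i _.
  under eq_bigr do rewrite mulrA -rmorphM.
  rewrite -mulr_suml -rmorph_sum /=.
  have := congr1 (fun B : 'rV_3 => B ord0 i) vA; rewrite !mxE => e.
  rewrite [X in ratr X](_ : _ = 0) ?rmorph0 ?mul0r // -[RHS]e.
  by apply: eq_bigr => j _; rewrite mxE.
apply: (@size_icot_dependent F 4 m) => //.
  by move=> y ys; split; [exact: hm | case/mapP: ys => t /gP[_ h _] ->].
rewrite map_inj_in_uniq // => t t' /gP[_ _ {2}<-] /gP[_ _ {2}<-] -> //.
Qed.

Lemma is_rat_ratr (x : R) : is_rat x -> exists r : rat, x = ratr r.
Proof.
case=> -[n d] ->; rewrite /Q2R /=.
have Zr z : exists r : rat, IZR z = ratr r.
  have [k [->|->]] : exists k : nat, z = Z.of_nat k \/ z = Z.opp (Z.of_nat k).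
    by exists (Z.abs_nat z); lia.
  - by exists k%:R; rewrite -INR_IZR_INZ INRE rmorph_nat.
  - by exists (- k%:R); rewrite opp_IZR -INR_IZR_INZ INRE rmorphN rmorph_nat.
have [a ->] := Zr n; have [b ->] := Zr (Z.pos d).
by exists (a / b); rewrite fmorph_div /=.
Qed.

Lemma expi_pow (t : R) (n : nat) :
  Complex (cos t) (sin t) ^+ n = Complex (cos (Rmult (INR n) t)) (sin (Rmult (INR n) t)).
Proof.
elim: n => [|n IH]; first by rewrite expr0 /= Rmult_0_l cos_0 sin_0.
have -> : Rmult (INR n.+1) t = Rplus t (Rmult (INR n) t)
  by rewrite S_INR Rmult_plus_distr_r Rmult_1_l Rplus_comm.
by rewrite exprS IH cos_plus sin_plus; congr Complex; rewrite [RHS]Rplus_comm.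
Qed.

(** The root of unity is [exp (2 i t)], killed by the denominator of [q]. *)
Lemma imaginary_cot_icot (q : Q) (t : R) :
  t = Rmult (Q2R q) PI -> sin t <> 0 ->
  exists y n, [/\ y != 1, (0 < n)%N, y ^+ n = 1 &
    Complex 0 (Rdiv (cos t) (sin t)) = icot y :> complex R].
Proof.
move=> Et st.
exists (Complex (cos (Rmult 2 t)) (sin (Rmult 2 t))), (Pos.to_nat (Qden q)).
have y1 : Complex (cos (Rmult 2 t)) (sin (Rmult 2 t)) != 1.
  by apply/eqP => -[/cos_double_eq1].
split=> //; first by apply/ssrnat.ltP; exact: Pos2Nat.is_pos.
  rewrite expi_pow Et Qden_mul_angle.
  by have [-> ->] := cos_sin_2IZR (Qnum q).
rewrite /icot; apply: (canRL (mulfK _)); first by rewrite subr_eq0 eq_sym.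
have [E1 E2] := cot_double_angle t st.
apply/eqP; rewrite eq_complex /=; apply/andP; split; apply/eqP.
  by rewrite mul0r !sub0r mulrN opprK; exact: E1.
by rewrite mul0r !add0r; exact: E2.
Qed.

Lemma Complex_real_scal (x y : R) : Complex 0 (x * y) = Complex x 0 * Complex 0 y.
Proof. by apply/eqP; rewrite eq_complex /= !mulr0 !mul0r subrr addr0 !eqxx. Qed.

Lemma angle_cot_span (u w : C) (A : (C -> Prop) * (C -> Prop)) (k : R) :
  angle_cot u w A k -> exists a : 'I_3 -> rat,
  Complex 0 k = \sum_j ratr (a j) *
    Complex 0 (tnth [tuple Rdiv (dot u u) (cross u w); Rdiv (dot w w) (cross u w);
                      Rdiv (dot u w) (cross u w)] j).
Proof.
case/angle_cot_lincomb => a [b [c [/is_rat_ratr[a' ->] [/is_rat_ratr[b' ->] [/is_rat_ratr[c' ->] ->]]]]].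
exists (tnth [tuple a'; b'; c']).
have rE (r : rat) (x : R) : ratr r * Complex 0 x = Complex 0 (ratr r * x).
  by rewrite Complex_real_scal -[Complex (ratr r) 0]/(real_complex R (ratr r)) fmorph_rat.
rewrite !big_ord_recl big_ord0 addr0 !rE /=.
apply/eqP; rewrite eq_complex /= !addr0; apply/andP; split=> //; apply/eqP.
by rewrite addrA.
Qed.

Lemma ForallOrdPairs_filter (T : Type) (P : T -> T -> Prop) (a : pred T) (l : seq T) :
  List.ForallOrdPairs P l -> List.ForallOrdPairs P (filter a l).
Proof.
elim=> [|x s xs _ IH] /=; first exact: List.FOP_nil.
case: (a x) => //; apply: List.FOP_cons => //.
elim: xs => [|y r Py _ IHr] /=; first exact: List.Forall_nil.
by case: (a y) => //; exact: List.Forall_cons.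
Qed.

(** Phrased with [List.In] because it is applied to pairs of predicates, which carry no [eqType]
    structure here. *)
Lemma count_le2 (T : Type) (P : T -> T -> Prop) (a : pred T) (l : seq T) :
  List.ForallOrdPairs P l ->
  (forall x y z, List.In x l -> List.In y l -> List.In z l ->
    a x -> a y -> a z -> P x y -> P x z -> P y z -> False) ->
  (count a l <= 2)%N.
Proof.
move=> /(ForallOrdPairs_filter a) Pl h; rewrite -size_filter.
have fl x : List.In x (filter a l) -> List.In x l /\ a x.
  elim: (l) => //= y s IH; case E: (a y) => /=; last by move=> /IH[]; split=> //; right.
  by case=> [<-|/IH[]]; split=> //; [left|right].
case: (filter a l) Pl fl => [|x [|y [|z s]]] // Pl fl; exfalso.
have [xl ax] := fl x (or_introl erefl).
have [yl ay] := fl y (or_intror (or_introl erefl)).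
have [zl az] := fl z (or_intror (or_intror (or_introl erefl))).
inversion_clear Pl as [|? ? H1 H2]; inversion_clear H1 as [|? ? Pxy H3].
inversion_clear H3 as [|? ? Pxz _]; inversion_clear H2 as [|? ? H4 _].
by inversion_clear H4 as [|? ? Pyz _]; exact: (h x y z).
Qed.

Theorem theorem6p1 (u w : C) :
  is_space u w -> ~ is_CM u w ->
  forall l : list ((C -> Prop) * (C -> Prop)),
    List.Forall (rational_angle u w) l ->
    List.ForallOrdPairs (fun A B => ~ angle_equiv A B) l ->
    Z.le (Z.of_nat (length l)) angle_bound.
Proof.
move=> _ nCM l ratl ndl.
pose cot_of A k := angle_cot u w A k /\
  exists q : Q, sin (Rmult (Q2R q) PI) <> 0 /\
    k = Rdiv (cos (Rmult (Q2R q) PI)) (sin (Rmult (Q2R q) PI)).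
(* Cotangents are chosen classically, since an angle is given only by its two lines. *)
pose f A : R := epsilon (inhabits (0 : R)) (cot_of A).
have fP A : List.In A l -> cot_of A (f A).
  move=> Al; apply: epsilon_spec; apply: rational_angle_cot.
  exact: (proj1 (List.Forall_forall _ _) ratl).
have fl x : x \in map f l -> exists2 A, List.In A l & x = f A.
  elim: (l) => //= A s IH; rewrite in_cons => /orP[/eqP ->|/IH[B Bs ->]].
    by exists A => //; left.
  by exists B => //; right.
(* Three inequivalent angles with the same cotangent would make the space CM. *)
have fib (b : R) : (count (fun x => x == b) (map f l) <= 2)%N.
  rewrite count_map; apply: (count_le2 ndl) => A B D /fP[hA _] /fP[hB _] /fP[hD _].
  move=> /= /eqP eA /eqP eB /eqP eD; rewrite eA in hA; rewrite eB in hB; rewrite eD in hD.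
  by move=> AB AD BD; apply: nCM; exact: (three_equal_cot_CM _ _ _ _ _ _ hA hB hD AB AD BD).
have sz : (size (map f l) <= 2 * size (undup (map f l)))%N.
  by apply: (size_le_fibers (f := id)) => [x|b _]; [rewrite mem_undup|exact: fib].
pose E := fun j : 'I_3 => Complex 0 (tnth [tuple Rdiv (dot u u) (cross u w);
  Rdiv (dot w w) (cross u w); Rdiv (dot u w) (cross u w)] j).
have szu : (size [seq Complex 0%R k | k <- undup (map f l)] <= 1800 + 75 * 4)%N.
  apply: (size_icot_span (E := E)).
  - by rewrite map_inj_uniq ?undup_uniq // => x y [].
  - move=> t /seq.mapP[k]; rewrite mem_undup => /fl[A /fP[_ [q [sq ->]]] ->] ->.
    exact: imaginary_cot_icot sq.
  - move=> t /seq.mapP[k]; rewrite mem_undup => /fl[A /fP[hA _] ->] ->.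
    exact: angle_cot_span hA.
rewrite !size_map in sz szu.
(* Two angles per cotangent and at most [1800 + 75 * 4 = 2100] cotangents; 4200 is far below
   [angle_bound]. *)
have ll : (length l <= 4200)%N by apply: leq_trans sz _; rewrite (leq_mul (leqnn 2) szu).
apply: (Z.le_trans _ (Z.of_nat 4200)); first by apply/inj_le/ssrnat.leP.
by apply: Zle_bool_imp_le; vm_compute.
Qed.
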